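(* Let $\nu=\sum_{k=1}^K p^{(k)}\nu^{(k)}$ be a mixture model on $\mathbb{R}^d$ satisfying the standing assumptions below, and suppose there is $\beta\in\mathbb{R}$ such that for all $i\in[d]$, $$\beta\cdot \mathbb{E}_{x\sim\nu}\big[|x_i-\mu_i(x)|\big]\ \ge\ \sqrt{\mathbb{E}_{x\sim\nu}\big[|x_i-\mu_i(x)|^2\big]}.$$ Let $q=ENR(\nu)$. Then there exists a decision tree $T$ (in the sense defined below) such that $$Price(\nu,T)\ \le\ 1+\frac{(4+2\pi^2/3)\,\alpha\beta K(K-1)}{\sqrt{q}}$$ (the right-hand side being read as $+\infty$ if $q=0$).
   Context: Standing assumptions: $\nu=\sum_{k=1}^K p^{(k)}\nu^{(k)}$ with $\sum_k p^{(k)}=1$, where each $\nu^{(k)}$ is a discrete or absolutely continuous probability distribution on $\mathbb{R}^d$ with mean $\mu^{(k)}\in\mathbb{R}^d$, whose density or probability mass function is symmetric about $\mu^{(k)}$ (so mean and median coincide). Every component has the same finite coordinate-wise variances $\sigma_1^2,\dots,\sigma_d^2>0$ (i.e. $\mathrm{Var}_{x\sim\nu^{(k)}}(x_j)=\sigma_j^2$ for all $k,j$). The mixing weights satisfy $p^{(k)}\le\alpha/K$ for all $k$, for some fixed $\alpha\ge1$. Sampling $x\sim\nu$ means first drawing a component $k$ with probability $p^{(k)}$ and then $x\sim\nu^{(k)}$; we set $\mu(x)=\mu^{(k)}$ for that component. Explainability-to-noise ratio: $ENR(\nu)=\min_{k\ne l}\max_{j\in[d]}|\mu^{(k)}_j-\mu^{(l)}_j|^2/\sigma_j^2$.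 A decision tree is a binary tree with $K$ leaves in which every internal node splits by an axis-aligned threshold cut $x_i\le\theta$ vs. $x_i>\theta$ (some $i\in[d]$, $\theta\in\mathbb{R}$), so that the leaves partition $\mathbb{R}^d$, and such that each leaf contains exactly one of the means $\mu^{(1)},\dots,\mu^{(K)}$. For $x$, let $\tilde\mu(x)$ be a median of the leaf containing $x$, i.e. a minimizer $c$ of $\mathbb{E}[\|x'-c\|_1\mid x' \text{ in that leaf}]$, $x'\sim\nu$ (a coordinate-wise median of $\nu$ restricted to the leaf). The price of explainability is $$Price(\nu,T)=\frac{\mathbb{E}_{x\sim\nu}[\|x-\tilde\mu(x)\|_1]}{\mathbb{E}_{x\sim\nu}[\|x-\mu(x)\|_1]}.$$
   Formalization: The formal theorem assumes q = ENR(ν) ≠ 0: if q = 0 two means coincide, so no tree with K leaves each containing exactly one mean exists and the existence claim fails. *)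

(* Defs.v *)
(* with MathComp-Analysis.  R^d is modelled as d.-tuple R,
   equipped with the library's product (Borel) sigma-algebra. *)
From mathcomp Require Import all_boot all_order all_algebra.
From mathcomp Require Import all_classical all_reals all_analysis.
Set Implicit Arguments. Unset Strict Implicit. Unset Printing Implicit Defensive.
Import Order.TTheory GRing.Theory Num.Theory.
Local Open Scope classical_set_scope.
Local Open Scope ring_scope.

Section Defs.
Variables (R : realType) (d K : nat).

Definition l1dist (x y : d.-tuple R) : R :=
  \sum_(j < d) `|tnth x j - tnth y j|.

Definition reflect_at (m x : d.-tuple R) : d.-tuple R :=
  [tuple (2 * tnth m j - tnth x j) | j < d].

Definition box (a b : d.-tuple R) : set (d.-tuple R) :=
  [set x | forall j, tnth a j <= tnth x j <= tnth b j].
Definition box_vol (a b : d.-tuple R) : R :=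
  \prod_(j < d) Num.max 0 (tnth b j - tnth a j).

(** Lebesgue-null subsets of R^d: coverable by countably many boxes of
    arbitrarily small total volume (outer Lebesgue measure zero). *)
Definition lebesgue_null (A : set (d.-tuple R)) : Prop :=
  forall eps : R, 0 < eps -> exists a b : nat -> d.-tuple R,
    A `<=` \bigcup_n box (a n) (b n) /\
    (\sum_(0 <= n <oo) (box_vol (a n) (b n))%:E < eps%:E)%E.

Definition abs_continuous (P : probability (d.-tuple R) R) : Prop :=
  forall A, measurable A -> lebesgue_null A -> P A = 0%E.

Definition discrete_distr (P : probability (d.-tuple R) R) : Prop :=
  exists S : set (d.-tuple R), countable S /\ measurable S /\ P S = 1%E.

Definition symmetric_about (P : probability (d.-tuple R) R) (m : d.-tuple R)
  : Prop :=
  forall A, measurable A -> P A = P (reflect_at m @^-1` A).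

Definition has_mean (P : probability (d.-tuple R) R) (m : d.-tuple R) : Prop :=
  forall j : 'I_d,
    P.-integrable setT (fun x => (tnth x j)%:E) /\
    (\int[P]_x (tnth x j)%:E = (tnth m j)%:E)%E.

Definition coord_variance (P : probability (d.-tuple R) R) (m : d.-tuple R)
  (j : 'I_d) (s2 : R) : Prop :=
  (\int[P]_x ((tnth x j - tnth m j) ^+ 2)%:E = s2%:E)%E.

(** ---------- Mixture-model expectations ----------
   For x ~ nu = sum_k p_k nu_k (x drawn from component k, mu(x) = mu_k),
   E_nu[g(x, mu(x))] = sum_k p_k E_{nu_k}[g(x, mu_k)]. *)

Variables (nu : 'I_K -> probability (d.-tuple R) R) (p : 'I_K -> R)
  (mu : 'I_K -> d.-tuple R).

Definition mix_expect (g : d.-tuple R -> d.-tuple R -> R) : \bar R :=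
  (\sum_(k < K) (p k)%:E * \int[nu k]_x (g x (mu k))%:E)%E.

Definition mix_abs_dev (i : 'I_d) : \bar R :=
  mix_expect (fun x m => `|tnth x i - tnth m i|).
Definition mix_sq_dev (i : 'I_d) : \bar R :=
  mix_expect (fun x m => `|tnth x i - tnth m i| ^+ 2).

(** explainability-to-noise ratio, min over k <> l (= +oo if K <= 1) of
    max_j |mu_k,j - mu_l,j|^2 / sigma_j^2 *)
Definition ENR (sigma : 'I_d -> R) : \bar R :=
  (\big[Order.min/+oo]_(k < K) \big[Order.min/+oo]_(l < K | l != k)
     (\big[Num.max/0]_(j < d)
        (`|tnth (mu k) j - tnth (mu l) j| ^+ 2 / sigma j ^+ 2))%:E)%E.

End Defs.

Inductive dtree (R : Type) (d : nat) : Type :=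
| DLeaf : dtree R d
| DNode : 'I_d -> R -> dtree R d -> dtree R d -> dtree R d.
Arguments DLeaf {R d}.

Fixpoint nleaves (R : Type) (d : nat) (T : dtree R d) : nat :=
  match T with
  | DLeaf => 1
  | DNode _ _ l r => nleaves l + nleaves r
  end.

(** index (in 0 .. nleaves T - 1, left to right) of the leaf containing x;
    a node (i, theta) sends x to the left iff x_i <= theta *)
Fixpoint leaf_of (R : realType) (d : nat) (T : dtree R d) (x : d.-tuple R)
  : nat :=
  match T with
  | DLeaf => 0
  | DNode i th l r =>
      if tnth x i <= th then leaf_of l x else nleaves l + leaf_of r x
  end.

Section Price.
Variables (R : realType) (d K : nat).
Variables (nu : 'I_K -> probability (d.-tuple R) R) (p : 'I_K -> R)
  (mu : 'I_K -> d.-tuple R).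

Definition valid_tree (T : dtree R d) : Prop :=
  nleaves T = K /\
  forall L, (L < nleaves T)%N -> exists! k : 'I_K, leaf_of T (mu k) = L.

(** c is a choice of medians of the leaves: c L minimises
    E_nu[ ||x - c||_1 ; x in leaf L ]  (equivalently the conditional
    expectation given the leaf, when the leaf has positive mass) *)
Definition leaf_medians (T : dtree R d) (c : nat -> d.-tuple R) : Prop :=
  forall L, (L < nleaves T)%N -> forall y : d.-tuple R,
    (\sum_(k < K) (p k)%:E *
       \int[nu k]_(x in [set x | leaf_of T x = L]) (l1dist x (c L))%:E <=
     \sum_(k < K) (p k)%:E *
       \int[nu k]_(x in [set x | leaf_of T x = L]) (l1dist x y)%:E)%E.

Definition price (T : dtree R d) (c : nat -> d.-tuple R) : \bar R :=
  ((\sum_(k < K) (p k)%:E * \int[nu k]_x (l1dist x (c (leaf_of T x)))%:E) *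
   ((fine (mix_expect nu p mu (fun x m => l1dist x m)))^-1)%:E)%E.

End Price.

Definition price_bound (R : realType) (C : R) (q : \bar R) : \bar R :=
  match q with
  | EFin r => if r == 0 then +oo%E else (1 + C / Num.sqrt r)%:E
  | +oo%E => 1%:E
  | -oo%E => +oo%E
  end.

(* Main.v *)
Require Import Defs.
From mathcomp Require Import all_boot all_order all_algebra.
From mathcomp Require Import all_classical all_reals all_analysis.
From mathcomp Require Import measurable_realfun.
From mathcomp Require Import ring lra.

(** Replacing the leaf medians by the means that share their leaves can only
    increase the cost, so it suffices to bound the expected displacement
    [||mu(x) - mu_leaf(x)||_1], which is paid when a cut separates [x] from its
    mean.  A node with [m] means is cut along the coordinate [i] of largest spread
    [rho] relative to [sigma].  Averaging [1 / (t^2 + r^2)] over the thresholds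
    (its primitive is an arctangent) yields a threshold whose distances [t_k] to the
    means satisfy [\sum_k 1 / t_k^2 <= 4 pi^2 (m - 1)^2 / (rho sigma_i)^2].  By
    symmetry the tail bound is [sigma_i^2 / (2 t_k^2)], and each separated point pays
    at most [rho * \sum_j sigma_j], so the node costs at most
    [2 pi^2 (m - 1)^2 * \sum_j sigma_j / sqrt q].  These costs add up over the tree
    to [(2 pi^2 / 3) K^2 (K - 1) * \sum_j sigma_j / sqrt q], and the hypothesis on
    [beta] turns [\sum_j sigma_j] into the denominator of the price. *)

Import Order.TTheory GRing.Theory Num.Theory.
Import numFieldNormedType.Exports.
Local Open Scope classical_set_scope.
Local Open Scope ring_scope.

(** * Choosing a threshold far from all means *)

Lemma is_derive_bigsum {R : realType} (I : Type) (r : seq I) (P : pred I)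
  (h : I -> R -> R) (dh : I -> R) (x : R) :
  (forall i, is_derive x 1 (h i) (dh i)) ->
  is_derive x 1 (fun z => \sum_(i <- r | P i) h i z) (\sum_(i <- r | P i) dh i).
Proof.
move=> hd; elim: r => [|i r IH].
  under eq_fun do rewrite big_nil.
  by rewrite big_nil; exact: is_derive_cst.
under eq_fun do rewrite big_cons.
rewrite big_cons; case: (P i) => //.
exact: is_deriveD.
Qed.

Lemma is_derive_atan_scaled {R : realType} (r y x : R) : 0 < r ->
  is_derive x 1 (fun z => r^-1 * atan (r^-1 * (z - y)))
    (((y - x) ^+ 2 + r ^+ 2)^-1).
Proof.
move=> r0.
have H1 : is_derive x 1 (fun z => r^-1 * (z - y)) r^-1.
  have := @is_deriveZ _ _ _ (fun z : R => z - y) r^-1 x 1 1.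
  rewrite /GRing.scale /= mulr1; apply.
  by rewrite -[X in is_derive _ _ _ X]subr0; apply: is_deriveB.
have H2 := @is_derive1_comp _ atan (fun z => r^-1 * (z - y)) x _ _
  (is_derive1_atan (r^-1 * (x - y))) H1.
have := is_deriveZ (R := R) (f := atan \o (fun z => r^-1 * (z - y))) r^-1.
move=> /(_ _ _ _ H2); rewrite /GRing.scale /=.
set a := (X in is_derive _ _ _ X -> _).
suff -> : a = ((y - x) ^+ 2 + r ^+ 2)^-1 by [].
rewrite /a; have rn : r != 0 by rewrite gt_eqF.
have h1 : 0 < (y - x) ^+ 2 + r ^+ 2 by rewrite ltr_wpDl ?sqr_ge0 ?exprn_gt0.
have h2 : 0 < r ^+ 2 + (x - y) ^+ 2 by rewrite ltr_pwDl ?sqr_ge0 ?exprn_gt0.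
by field; rewrite rn !gt_eqF.
Qed.

(** The arctangent stays within [pi / 2] of zero on either side, so each endpoint contributes at
    most [pi / 2 / r]. An endpoint equal to [y] contributes nothing, and recording this with the
    indicators is what later yields [m - 1] instead of [m]. *)
Lemma atan_scaled_increment {R : realType} (r y a b : R) : 0 < r ->
  a <= y <= b ->
  r^-1 * atan (r^-1 * (b - y)) - r^-1 * atan (r^-1 * (a - y)) <=
  pi / 2 / r * ((y != a)%:R + (y != b)%:R).
Proof.
move=> r0 /andP[ay yb].
have ri : 0 <= r^-1 by rewrite invr_ge0 ltW.
rewrite -mulrBr [leRHS]mulrAC [leRHS]mulrC.
rewrite ler_wpM2l// [leRHS]mulrDr [leRHS]addrC; apply: lerD.
  case: eqVneq => [->|_]; first by rewrite subrr mulr0 atan0 mulr0.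
  by rewrite mulr1 ltW// atan_ltpi2.
case: eqVneq => [->|_]; first by rewrite subrr mulr0 atan0 mulr0 oppr0.
by rewrite mulr1 lerNl ltW// atan_gtNpi2.
Qed.

(* With [r = D / (2 pi (m - 1))], the mean value theorem gives a threshold where
   the regularised sum of [1 / (t_k^2 + r^2)] is at most [1 / (2 r^2)]; then every
   distance [t_k] is at least [r], and removing the regularisation costs only a
   factor two. *)
Lemma exists_far_threshold {R : realType} {I : finType} {A : {set I}}
  {y : I -> R} {k0 k1 : I} :
  k0 \in A -> k1 \in A -> y k0 < y k1 ->
  (forall k, k \in A -> y k0 <= y k <= y k1) ->
  exists th, [/\ y k0 < th < y k1, forall k, k \in A -> y k != th &
    \sum_(k in A) ((y k - th) ^+ 2)^-1 <=
    4 * pi ^+ 2 * (#|A|%:R - 1) ^+ 2 / (y k1 - y k0) ^+ 2].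
Proof.
move=> Ak0 Ak1 lt01 ybnd.
have k01 : k1 != k0 by apply: contraTneq lt01 => ->; rewrite ltxx.
have m2 : 0 < #|A|%:R - 1 :> R.
  rewrite subr_gt0 -[1]/(1%:R) ltr_nat; apply/card_gt1P.
  by exists k1, k0.
(* [field] would unfold [pi], hence the variable [c]. *)
have [c cE] : exists c : R, c = pi by exists pi.
have c0 : 0 < c by rewrite cE pi_gt0.
rewrite -cE.
set D := y k1 - y k0; have D0 : 0 < D by rewrite subr_gt0.
set m1 := _ - 1 in m2 *.
pose r := D / (2 * c * m1).
have r0 : 0 < r by rewrite divr_gt0// !mulr_gt0.
pose F th := \sum_(k in A) r^-1 * atan (r^-1 * (th - y k)).
pose dF th := \sum_(k in A) ((y k - th) ^+ 2 + r ^+ 2)^-1.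
have dFP (x : R) : is_derive x 1 F (dF x).
  by apply: is_derive_bigsum => i; exact: is_derive_atan_scaled.
have Fcont : {within `[y k0, y k1], continuous F}.
  apply: continuous_subspaceT => x.
  apply: differentiable_continuous; apply/derivable1_diffP.
  exact: ex_derive.
have [th thin Fth] := MVT lt01 (fun x _ => dFP x) Fcont.
have incr : F (y k1) - F (y k0) <= c / r * m1.
  rewrite -sumrB.
  apply: (@le_trans _ _ (\sum_(k in A)
      c / 2 / r * ((y k != y k0)%:R + (y k != y k1)%:R))).
    rewrite cE; apply: ler_sum => k kA; apply: atan_scaled_increment => //; exact: ybnd.
  rewrite -mulr_sumr big_split /=.
  (* The summand [k = l] vanishes, so each of the two extreme points [k0], [k1] is charged at most
     [m - 1] times. *)
  have cnt l : l \in A -> \sum_(k in A) (y k != y l)%:R <= m1 :> R.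
    move=> lA; rewrite (bigD1 l) //= eqxx add0r /m1 (cardsD1 l) lA natrD addrC addKr.
    rewrite -sum1_card natr_sum.
    rewrite [leRHS](eq_bigl (fun k => (k \in A) && (k != l))); last first.
      by move=> k; rewrite !inE andbC.
    by apply: ler_sum => k _; case: (_ != _); rewrite ?lexx ?ler01.
  have -> : c / r * m1 = c / 2 / r * (m1 + m1) by field; rewrite gt_eqF.
  apply: ler_wpM2l; last by apply: lerD; exact: cnt.
  by apply: divr_ge0; [apply: divr_ge0|] => //; exact: ltW.
have S : dF th <= (2 * r ^+ 2)^-1.
  rewrite -(ler_pM2r D0) -Fth; apply: le_trans incr _.
  rewrite /r le_eqVlt; apply/orP; left; apply/eqP; field.
  by rewrite !gt_eqF.
have r20 : 0 < r ^+ 2 by rewrite exprn_gt0.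
have far k : k \in A -> r ^+ 2 <= (y k - th) ^+ 2.
  move=> kA; have : ((y k - th) ^+ 2 + r ^+ 2)^-1 <= (2 * r ^+ 2)^-1.
    apply: le_trans S; rewrite /dF (bigD1 k)//= lerDl sumr_ge0// => i _.
    by rewrite invr_ge0 addr_ge0 ?sqr_ge0.
  rewrite lef_pV2 ?posrE; [lra|by rewrite ltr_wpDl ?sqr_ge0|by rewrite mulr_gt0].
have sq0 k : k \in A -> 0 < (y k - th) ^+ 2.
  by move=> kA; exact: lt_le_trans (far k kA).
exists th; split.
- by move: thin; rewrite in_itv.
- move=> k kA; have := sq0 k kA; apply: contraTneq => ->.
  by rewrite subrr expr0n ltxx.
- apply: (@le_trans _ _ (2 * dF th)).
    rewrite /dF mulr_sumr; apply: ler_sum => k kA.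
    have h1 := far k kA; have h2 := sq0 k kA.
    have h3 : 0 < (y k - th) ^+ 2 + r ^+ 2 by rewrite addr_gt0.
    rewrite -(ler_pM2r h3) -mulrA mulVf ?gt_eqF// mulr1.
    by rewrite mulrC ler_pdivrMr//; lra.
  apply: (@le_trans _ _ (2 * (2 * r ^+ 2)^-1)); first by rewrite ler_pM2l.
  rewrite /r le_eqVlt; apply/orP; left; apply/eqP; field.
  by rewrite !gt_eqF.
Qed.

(** * Measurability, one-sided tails and comparison of integrals *)

Lemma measurable_coord {R : realType} {d : nat} (j : 'I_d) :
  measurable_fun [set: d.-tuple R] (fun x : d.-tuple R => tnth x j).
Proof. exact: measurable_tnth. Qed.

Lemma measurable_coord_le {R : realType} {d : nat} (j : 'I_d) (a : R) :
  measurable [set x : d.-tuple R | tnth x j <= a].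
Proof.
have := @measurable_coord R d j measurableT _ (measurable_itv `]-oo, a]).
by rewrite setTI; congr (measurable _); apply/seteqP; split => x /=; rewrite in_itv.
Qed.

Lemma measurable_coord_ge {R : realType} {d : nat} (j : 'I_d) (a : R) :
  measurable [set x : d.-tuple R | a <= tnth x j].
Proof.
have := @measurable_coord R d j measurableT _ (measurable_itv `[a, +oo[).
rewrite setTI; congr (measurable _); apply/seteqP; split => x /=;
  by rewrite in_itv/= andbT.
Qed.

Lemma measurable_l1dist {R : realType} {d : nat} (y : d.-tuple R) :
  measurable_fun [set: d.-tuple R] (fun x : d.-tuple R => l1dist x y).
Proof.
apply: measurable_sum => j; apply: measurableT_comp => //.
by apply: measurable_funB => //; exact: measurable_coord.
Qed.

Lemma l1dist_ge0 {R : realType} {d : nat} (x y : d.-tuple R) : 0 <= l1dist x y.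
Proof. by apply: sumr_ge0 => j _. Qed.

Lemma l1dist_triangle {R : realType} {d : nat} (x y z : d.-tuple R) :
  l1dist x z <= l1dist x y + l1dist y z.
Proof.
rewrite /l1dist -big_split /=; apply: ler_sum => j _; exact: ler_distD.
Qed.

(** Reflection about [m] exchanges the two tails, so each carries half of the Chebyshev bound for
    their disjoint union. *)
Lemma symmetric_tail {R : realType} {d : nat}
  {P : probability (d.-tuple R) R} {m : d.-tuple R} {i : 'I_d} {s t : R} :
  symmetric_about P m -> coord_variance P m i s -> 0 < t ->
  (P [set x | (tnth m i + t <= tnth x i)%R] <= (s / (2 * t ^+ 2))%:E)%E /\
  (P [set x | (tnth x i <= tnth m i - t)%R] <= (s / (2 * t ^+ 2))%:E)%E.
Proof.
move=> sym var t0.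
set U := [set x | _]; set L := [set x | _].
have mU : measurable U by exact: measurable_coord_ge.
have mL : measurable L by exact: measurable_coord_le.
have PUL : P U = P L.
  rewrite (sym _ mU); congr (P _); apply/seteqP.
  split => x; rewrite /U /L /= tnth_mktuple; lra.
have mg : measurable_fun [set: d.-tuple R]
    (fun x : d.-tuple R => ((tnth x i - tnth m i) ^+ 2)%:E).
  apply/measurable_EFinP; apply: measurable_funX.
  by apply: measurable_funB => //; exact: measurable_coord.
have t20 : 0 < t ^+ 2 by rewrite exprn_gt0.
have cheb : ((t ^+ 2)%:E * P (U `|` L) <= s%:E)%E.
  rewrite -var.
  have := le_integral_abse P measurableT mg t20.
  under eq_integral do rewrite gee0_abs ?lee_fin ?sqr_ge0//.
  apply: le_trans; apply: lee_wpmul2l; first by rewrite lee_fin ltW.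
  apply: le_measure; rewrite ?inE.
  - exact: measurableU.
  - by apply: emeasurable_fun_c_infty => //; exact: measurableT_comp.
  - move=> x UL; split=> //=; rewrite lee_fin ger0_norm ?sqr_ge0//.
    by case: UL; rewrite /U /L /=; nra.
have dis : U `&` L = set0.
  by apply/seteqP; split => x //=; rewrite /U /L /=; lra.
have PU : P (U `|` L) = (P U + P L)%E by exact: measureU.
move: cheb; rewrite PU PUL -(fineK (fin_num_measure P _ mL)).
rewrite -EFinD -EFinM !lee_fin => h; split;
  rewrite ler_pdivlMr ?mulr_gt0//; lra.
Qed.

(** Pointwise [f] is at most [g] plus [D] times the indicator of [S]. In the application [f] is the
    displacement in a tree, [g] the one in a branch, and [S] a half-space containing every point
    that the cut sends to the other branch. *)
Lemma integral_le_off_set {R : realType} {d : measure_display}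
  {T : measurableType d} {P : {measure set T -> \bar R}} {f g : T -> R}
  {D u : R} {S : set T} :
  measurable_fun setT f -> measurable_fun setT g -> measurable S ->
  (forall x, 0 <= f x) -> (forall x, 0 <= g x) -> 0 <= D ->
  (forall x, ~ S x -> f x <= g x) -> (forall x, f x <= D) ->
  (P S <= u%:E)%E ->
  (\int[P]_x (f x)%:E <= \int[P]_x (g x)%:E + (D * u)%:E)%E.
Proof.
move=> mf mg mS f0 g0 D0 fg fD PS.
have mI : measurable_fun setT (fun x => (\1_S x : R)%:E).
  by apply/measurable_EFinP; exact: measurable_indic.
have I0 x : (0 <= (\1_S x : R)%:E)%E by rewrite lee_fin indicE ler0n.
have mDI : measurable_fun setT (fun x => D%:E * (\1_S x : R)%:E)%E.
  exact: measurable_funeM.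
have mg' : measurable_fun setT (fun x => (g x)%:E) by exact/measurable_EFinP.
apply: (@le_trans _ _ (\int[P]_x ((g x)%:E + D%:E * (\1_S x)%:E))%E).
  apply: ge0_le_integral => //.
  - by move=> x _; rewrite lee_fin.
  - exact/measurable_EFinP.
  - exact: emeasurable_funD.
  - move=> x _; rewrite -EFinM -EFinD lee_fin indicE.
    case: (pselect (S x)) => Sx.
      by rewrite mem_set// mulr1 (le_trans (fD x))// lerDr.
    by rewrite memNset// mulr0 addr0 fg.
rewrite ge0_integralD//; last 2 first.
- by move=> x _; rewrite lee_fin.
- by move=> x _; rewrite mule_ge0// lee_fin.
apply: leeD2l; rewrite ge0_integralZl ?lee_fin//.
rewrite integral_indic// setIT EFinM.
by apply: lee_wpmul2l; rewrite ?lee_fin.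
Qed.

(** * Trees separating a set of means, and their displacement cost *)

Lemma leaf_of_lt {R : realType} {d : nat} (T : dtree R d) (x : d.-tuple R) :
  (leaf_of T x < nleaves T)%N.
Proof.
elim: T => //= i th l IHl r IHr; case: ifP => _.
  by rewrite (leq_trans IHl)// leq_addr.
by rewrite ltn_add2l.
Qed.

(** The notion is relative to a set [A] of means so that it can be built by recursion on [A]; the
    tree and [rep] are nevertheless defined on all of R^d, and [rep x] is the mean of [A] that
    shares the leaf of [x]. Measurability of [rep] is expressed through its real-valued
    compositions, the form in which it enters the integrals. *)
Record separates {R : realType} {d K : nat} (mu : 'I_K -> d.-tuple R)
  (A : {set 'I_K}) (T : dtree R d) (rep : d.-tuple R -> 'I_K) : Prop :=
  Separates {
    sep_nleaves : nleaves T = #|A|;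
    sep_mem : forall x, rep x \in A;
    sep_leaf : forall x, leaf_of T (mu (rep x)) = leaf_of T x;
    sep_inj : {in A &, injective (fun k => leaf_of T (mu k))};
    sep_surj : forall L, (L < nleaves T)%N ->
      exists2 k, k \in A & leaf_of T (mu k) = L;
    sep_measurable : forall f : 'I_K -> R, measurable_fun setT (f \o rep) }.

Arguments sep_nleaves {R d K mu A T rep}.
Arguments sep_mem {R d K mu A T rep}.
Arguments sep_leaf {R d K mu A T rep}.
Arguments sep_inj {R d K mu A T rep}.
Arguments sep_surj {R d K mu A T rep}.
Arguments sep_measurable {R d K mu A T rep}.

Lemma separates_leaf {R : realType} {d K : nat} (mu : 'I_K -> d.-tuple R)
  (k : 'I_K) : separates mu [set k] DLeaf (fun=> k).
Proof.
split => //=.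
- by rewrite cards1.
- by move=> _; rewrite set11.
- by move=> a b; rewrite !inE => /eqP -> /eqP ->.
- by case=> // _; exists k; rewrite ?set11.
- by move=> f; exact: measurable_cst.
Qed.

(** The cut sends every mean of [A] into the branch built for it, and the offset [nleaves Tl] keeps
    the leaf indices of the two branches disjoint. *)
Lemma separates_node {R : realType} {d K : nat} {mu : 'I_K -> d.-tuple R}
  {A B : {set 'I_K}} {i : 'I_d} {th : R} {Tl Tr : dtree R d}
  {repl repr : d.-tuple R -> 'I_K} :
  B = [set k | tnth (mu k) i <= th]%SET ->
  separates mu (A :&: B) Tl repl -> separates mu (A :\: B) Tr repr ->
  separates mu A (DNode i th Tl Tr)
    (fun x => if tnth x i <= th then repl x else repr x).
Proof.
move=> BE [nl ml ll il sl msl] [nr mr lr ir sr msr].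
have inB k : (k \in B) = (tnth (mu k) i <= th) by rewrite BE inE.
have mlB x : tnth (mu (repl x)) i <= th.
  by have := ml x; rewrite inE inB => /andP[].
have mrB x : (tnth (mu (repr x)) i <= th) = false.
  by have := mr x; rewrite inE inB => /andP[/negbTE].
split.
- by rewrite /= nl nr cardsID.
- move=> x; case: ifP => _; first by have := ml x; rewrite inE => /andP[].
  by have := mr x; rewrite inE => /andP[].
- by move=> x /=; case: (tnth x i <= th); rewrite ?mlB ?mrB ?ll ?lr.
- move=> a b aA bA /=.
  have lta := leaf_of_lt Tl (mu a); have ltb := leaf_of_lt Tl (mu b).
  case: ifP => ta; case: ifP => tb.
  + by move=> e; apply: il => //; rewrite inE inB ?ta ?tb ?aA ?bA.
  + by move=> e; move: lta; rewrite e ltnNge leq_addr.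
  + by move=> e; move: ltb; rewrite -e ltnNge leq_addr.
  + by move=> /addnI e; apply: ir => //; rewrite inE inB ?ta ?tb ?aA ?bA.
- move=> L /= LT; have [Ll|Ll] := ltnP L (nleaves Tl).
    have [k] := sl _ Ll; rewrite inE inB => /andP[kA kB] kL.
    by exists k => //; rewrite kB.
  have [|k] := sr (L - nleaves Tl)%N; first by rewrite ltn_subLR.
  rewrite inE inB => /andP[/negbTE kB kA] kL.
  by exists k => //=; rewrite kB kL; exact: subnKC.
- move=> f; rewrite (_ : f \o _ =
      (fun x => if tnth x i <= th then f (repl x) else f (repr x))).
    apply: measurable_fun_ifT; [|exact: msl|exact: msr].
    by apply: measurable_fun_ler => //; exact: measurable_coord.
  by apply/funext => x /=; case: ifP.
Qed.

(* Makes node costs of [3 (m - 1)^2] sum up to at most [m^2 (m - 1)]. *)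
Lemma card_split_ineq {R : realType} (a b : R) : 1 <= a -> 1 <= b ->
  a ^+ 2 * (a - 1) + b ^+ 2 * (b - 1) + 3 * (a + b - 1) ^+ 2 <=
  (a + b) ^+ 2 * (a + b - 1).
Proof.
move=> a1 b1; have ab : 0 <= (a - 1) * (b - 1) by rewrite mulr_ge0 ?subr_ge0.
have h : 0 <= (a - 1) * (b - 1) * (3 * (a + b) - 2) by rewrite mulr_ge0//; lra.
rewrite -subr_ge0.
rewrite (_ : _ - _ = (a - 1) * (b - 1) * (3 * (a + b) - 2) + (a + b - 1)); last by ring.
by rewrite addr_ge0//; lra.
Qed.

(* Cut along the coordinate with the largest spread [rho] relative to [sigma], so
   that misassigning a point costs at most [rho * \sum_j sigma j]; the Chebyshev
   bound at [exists_far_threshold] gains [rho ^- 2]. *)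
Lemma exists_separating_tree {R : realType} {d K : nat}
  (nu : 'I_K -> probability (d.-tuple R) R) (mu : 'I_K -> d.-tuple R)
  (sigma : 'I_d -> R) (rho0 : R) (A : {set 'I_K}) :
  (forall k, symmetric_about (nu k) (mu k)) ->
  (forall j, 0 < sigma j) ->
  (forall k j, coord_variance (nu k) (mu k) j (sigma j ^+ 2)) ->
  0 < rho0 ->
  (forall k l, k != l ->
     exists j, rho0 * sigma j <= `|tnth (mu k) j - tnth (mu l) j|) ->
  (0 < #|A|)%N ->
  exists (T : dtree R d) (rep : d.-tuple R -> 'I_K), separates mu A T rep /\
    (\sum_(k in A) \int[nu k]_x (l1dist (mu k) (mu (rep x)))%:E <=
     (2 * pi ^+ 2 / 3 * (\sum_j sigma j) / rho0
      * (#|A|%:R ^+ 2 * (#|A|%:R - 1)))%:E)%E.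
Proof.
move=> sym sig0 var rho00 far.
set s := \sum_j sigma j.
have s0 : 0 <= s by apply: sumr_ge0 => j _; exact: ltW.
have [n] := ubnP #|A|; elim: n A => // n IH A; rewrite ltnS => An A0.
have [A1|A2] := leqP #|A| 1.
  have /cards1P[k ->] : #|A| == 1%N by rewrite eqn_leq A1.
  exists DLeaf, (fun=> k); split; first exact: separates_leaf.
  rewrite big_set1 integral_cst// /l1dist big1 ?mul0e.
    by rewrite cards1 subrr !mulr0.
  by move=> j _; rewrite subrr normr0.
(* The difference is signed: maximising over ordered pairs takes care of the absolute value and
   returns the two extreme means already in order. *)
pose F (t : 'I_d * 'I_K * 'I_K) :=
  (tnth (mu t.1.2) t.1.1 - tnth (mu t.2) t.1.1) / sigma t.1.1.
pose inA (t : 'I_d * 'I_K * 'I_K) := (t.1.2 \in A) && (t.2 \in A).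
have [t0 t0A Ft0] : exists2 t, inA t & rho0 <= F t.
  have /card_gt1P[k [l [kA lA kl]]] := A2.
  have [j] := far _ _ kl; rewrite /F /inA.
  have [_ h|_ h] := ger0P (tnth (mu k) j - tnth (mu l) j).
    by exists (j, k, l); rewrite /= ?kA// ler_pdivlMr.
  by exists (j, l, k); rewrite /= ?lA// ler_pdivlMr// -opprB.
have [[[i k1] k0] /andP[/= k1A k0A] Fmax] := arg_maxP F t0A.
set rho := F (i, k1, k0) in Fmax.
have rho0rho : rho0 <= rho by apply: le_trans Ft0 _; exact: Fmax.
have rhopos : 0 < rho by exact: lt_le_trans rho0rho.
have diff_le j k l : k \in A -> l \in A ->
    tnth (mu k) j - tnth (mu l) j <= rho * sigma j.
  move=> kA lA; have := Fmax (j, k, l); rewrite /inA /= kA lA => /(_ isT).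
  by rewrite /F /= ler_pdivrMr.
have dist_le k l : k \in A -> l \in A -> l1dist (mu k) (mu l) <= rho * s.
  move=> kA lA; rewrite /l1dist mulr_sumr; apply: ler_sum => j _.
  by rewrite ler_norml lerNl opprB !diff_le.
pose y k := tnth (mu k) i.
have spread : y k1 - y k0 = rho * sigma i.
  by rewrite /rho /F /= divfK// gt_eqF.
have ybnd k : k \in A -> y k0 <= y k <= y k1.
  move=> kA; have := diff_le i k k0 kA k0A; have := diff_le i k1 k k1A kA.
  rewrite -spread /y; lra.
have y01 : y k0 < y k1 by rewrite -subr_gt0 spread mulr_gt0.
have [th [/andP[th0 th1] thN thsum]] := exists_far_threshold k0A k1A y01 ybnd.
pose B := [set k | y k <= th]%SET.
have cAB : (#|A :&: B| + #|A :\: B|)%N = #|A| by rewrite cardsID.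
have Bl0 : (0 < #|A :&: B|)%N.
  by apply/card_gt0P; exists k0; rewrite !inE k0A ltW.
have Br0 : (0 < #|A :\: B|)%N.
  by apply/card_gt0P; exists k1; rewrite !inE k1A -ltNge th1.
have [|Tl [repl [sepl costl]]] := IH (A :&: B) _ Bl0.
  by apply: leq_trans An; rewrite -cAB -[ltnLHS]addn0 ltn_add2l.
have [|Tr [repr [sepr costr]]] := IH (A :\: B) _ Br0.
  by apply: leq_trans An; rewrite -cAB -[ltnLHS]add0n ltn_add2r.
have sep := separates_node (erefl B) sepl sepr.
exists (DNode i th Tl Tr); eexists; split; first exact: sep.
set rep := fun x => _ in sep *.
have mrep k T' rep' A' : separates mu A' T' rep' ->
    measurable_fun setT (fun x => l1dist (mu k) (mu (rep' x))).
  by move=> h; exact: (sep_measurable h (fun l => l1dist (mu k) (mu l))).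
(* The largest possible displacement within [A], times the one-sided tail bound at distance
   [|y k - th|]. *)
pose e k := rho * s * (sigma i ^+ 2 / (2 * (y k - th) ^+ 2)).
have D0 : 0 <= rho * s by rewrite mulr_ge0// ltW.
(* Points with [x_i < th] stay in the left branch, where [rep] agrees with [repl]. The remaining
   half-space is a tail of [nu k] at distance [th - y k]. *)
have costL k : k \in A :&: B ->
    (\int[nu k]_x (l1dist (mu k) (mu (rep x)))%:E <=
     \int[nu k]_x (l1dist (mu k) (mu (repl x)))%:E + (e k)%:E)%E.
  rewrite !inE => /andP[kA kB].
  have t0' : 0 < th - y k by rewrite subr_gt0 lt_neqAle thN.
  have [tail _] := symmetric_tail (sym k) (var k i) t0'.
  rewrite -[(th - y k) ^+ 2]sqrrN opprB in tail.
  apply: (integral_le_off_set _ _ _ _ _ D0 _ _ tail).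
  - exact: mrep sep.
  - exact: mrep sepl.
  - exact: measurable_coord_ge.
  - by move=> x; exact: l1dist_ge0.
  - by move=> x; exact: l1dist_ge0.
  - move=> x /= /negP; rewrite -ltNge /y /rep => h.
    by have -> : tnth x i <= th by lra.
  - by move=> x; apply: dist_le => //; exact: sep_mem sep x.
have costR k : k \in A :\: B ->
    (\int[nu k]_x (l1dist (mu k) (mu (rep x)))%:E <=
     \int[nu k]_x (l1dist (mu k) (mu (repr x)))%:E + (e k)%:E)%E.
  rewrite !inE -ltNge => /andP[kB kA].
  have t0' : 0 < y k - th by rewrite subr_gt0.
  have [_ tail] := symmetric_tail (sym k) (var k i) t0'.
  apply: (integral_le_off_set _ _ _ _ _ D0 _ _ tail).
  - exact: mrep sep.
  - exact: mrep sepr.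
  - exact: measurable_coord_le.
  - by move=> x; exact: l1dist_ge0.
  - by move=> x; exact: l1dist_ge0.
  - move=> x /= /negP; rewrite -ltNge /y /rep => h.
    by have /lt_geF -> : th < tnth x i by lra.
  - by move=> x; apply: dist_le => //; exact: sep_mem sep x.
set C := 2 * pi ^+ 2 / 3 * s / rho0.
have C0 : 0 <= C.
  apply: divr_ge0; last exact: ltW.
  apply: mulr_ge0 => //; apply: divr_ge0 => //; apply: mulr_ge0 => //.
  exact: sqr_ge0.
(* As the spread is [rho * sigma i], both factors [sigma i] and one factor [rho] cancel, leaving
   [1 / rho <= 1 / rho0]. The [3] offsets the division by 3 in [C] and matches [card_split_ineq]. *)
have esum : \sum_(k in A) e k <= C * (3 * (#|A|%:R - 1) ^+ 2).
  have -> : \sum_(k in A) e k =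
      rho * s * sigma i ^+ 2 / 2 * \sum_(k in A) ((y k - th) ^+ 2)^-1.
    rewrite mulr_sumr; apply: eq_bigr => k kA.
    by rewrite /e invfM !mulrA.
  apply: (@le_trans _ _ (rho * s * sigma i ^+ 2 / 2 *
      (4 * pi ^+ 2 * (#|A|%:R - 1) ^+ 2 / (y k1 - y k0) ^+ 2))).
    apply: ler_wpM2l => //; rewrite mulr_ge0 ?invr_ge0//.
    by rewrite mulr_ge0// sqr_ge0.
  rewrite spread /C.
  have := sqr_ge0 (pi : R); move: (pi ^+ 2 : R) => c c0.
  have si := sig0 i; move: (#|A|%:R - 1 : R) => m1.
  rewrite (_ : _ / 2 * _ = 2 * c * s * m1 ^+ 2 / rho); last first.
    by field; rewrite !gt_eqF.
  rewrite (_ : _ / rho0 * _ = 2 * c * s * m1 ^+ 2 / rho0); last first.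
    by field; rewrite !gt_eqF.
  apply: ler_wpM2l; first by apply: mulr_ge0; rewrite ?sqr_ge0// !mulr_ge0.
  by rewrite lef_pV2.
rewrite (big_setID B) /=.
apply: (@le_trans _ _
   ((\sum_(k in A :&: B) (\int[nu k]_x (l1dist (mu k) (mu (repl x)))%:E + (e k)%:E)) +
    (\sum_(k in A :\: B) (\int[nu k]_x (l1dist (mu k) (mu (repr x)))%:E + (e k)%:E)))%E).
  by apply: leeD; apply: lee_sum.
have split_e (S : {set 'I_K}) (u : 'I_K -> \bar R) :
    (\sum_(k in S) (u k + (e k)%:E) =
     \sum_(k in S) u k + \sum_(k in S) (e k)%:E)%E by exact: big_split.
rewrite !split_e addeACA.
have -> : (\sum_(k in A :&: B) (e k)%:E + \sum_(k in A :\: B) (e k)%:E)%E =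
    (\sum_(k in A) e k)%:E.
  by rewrite [in RHS](big_setID B) /= EFinD !sumEFin.
apply: (@le_trans _ _ (((C * (#|A :&: B|%:R ^+ 2 * (#|A :&: B|%:R - 1)))%:E +
    (C * (#|A :\: B|%:R ^+ 2 * (#|A :\: B|%:R - 1)))%:E) +
    (C * (3 * (#|A|%:R - 1) ^+ 2))%:E)%E).
  apply: leeD; last by rewrite lee_fin.
  by apply: leeD; [exact: costl|exact: costr].
rewrite -!EFinD lee_fin -!mulrDr; apply: ler_wpM2l => //.
rewrite -cAB natrD; by apply: card_split_ineq; rewrite -[1]/(1%:R) ler_nat.
Qed.

(** * Leaf medians against representative means *)

Lemma measurable_leaf {R : realType} {d : nat} (T : dtree R d) (L : nat) :
  measurable [set x : d.-tuple R | leaf_of T x = L].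
Proof.
(* Composing with an arbitrary [g] lets the induction hypothesis absorb the index shift in the right
   branch. *)
suff h (g : nat -> nat) : measurable_fun setT (g \o @leaf_of R d T).
  have := h id measurableT [set L] I; rewrite setTI.
  by congr (measurable _); apply/seteqP; split.
elim: T g => [|i th l IHl r IHr] g /=.
  by rewrite (_ : _ \o _ = cst (g 0%N)); [exact: measurable_cst|].
rewrite (_ : _ \o _ = fun x => if tnth x i <= th then (g \o leaf_of l) x
    else ((fun n => g (nleaves l + n)%N) \o leaf_of r) x); last first.
  by apply/funext => x /=; case: ifP.
apply: measurable_fun_ifT; [|exact: IHl|exact: IHr].
by apply: measurable_fun_ler => //; exact: measurable_coord.
Qed.

Lemma integral_split_leaves {R : realType} {d : nat}
  (P : probability (d.-tuple R) R) (T : dtree R d) (f : nat -> d.-tuple R -> R) :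
  (forall L, measurable_fun setT (f L)) -> (forall L x, 0 <= f L x) ->
  (\int[P]_x (f (leaf_of T x) x)%:E =
   \sum_(L < nleaves T) \int[P]_(x in [set x | leaf_of T x = L]) (f L x)%:E)%E.
Proof.
move=> mf f0.
under [RHS]eq_bigr do rewrite integral_mkcond.
rewrite -ge0_integral_sum//; last 2 first.
- move=> L; apply/(measurable_restrictT _ (measurable_leaf T L)).
  by apply: measurable_funTS; apply/measurable_EFinP.
- by move=> L x _; rewrite patchE; case: ifP => // _; rewrite lee_fin.
apply: eq_integral => x _.
rewrite (bigD1 (Ordinal (leaf_of_lt T x)))//= patchE mem_set//=.
rewrite big1 ?adde0// => L neq; rewrite patchE memNset//= => e.
by move: neq; rewrite -val_eqE /= e eqxx.
Qed.

(** Since [rep] is constant on each leaf, its means are one admissible choice of centres. Minimality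
    of [c] applies leaf by leaf, and the leaves partition the space. *)
Lemma medians_le_representatives {R : realType} {d K : nat}
  (nu : 'I_K -> probability (d.-tuple R) R) (p : 'I_K -> R)
  (mu : 'I_K -> d.-tuple R) (A : {set 'I_K}) (T : dtree R d)
  (rep : d.-tuple R -> 'I_K) (c : nat -> d.-tuple R) :
  separates mu A T rep -> leaf_medians nu p T c ->
  (\sum_(k < K) (p k)%:E * \int[nu k]_x (l1dist x (c (leaf_of T x)))%:E <=
   \sum_(k < K) (p k)%:E * \int[nu k]_x (l1dist x (mu (rep x)))%:E)%E.
Proof.
move=> sep med.
(* The default only supplies some element of ['I_K]; on the leaf of a point [x] the search succeeds,
   with [rep x] as a witness. *)
pose g L := odflt (rep (c 0%N)) [pick k | (k \in A) && (leaf_of T (mu k) == L)].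
have repE x : rep x = g (leaf_of T x).
  rewrite /g; case: pickP => [k /andP[kA /eqP kx]|/(_ (rep x))] /=.
    by apply: (sep_inj sep) => //; rewrite ?(sep_mem sep)// (sep_leaf sep).
  by rewrite (sep_mem sep) (sep_leaf sep) eqxx.
have split_c (b : nat -> d.-tuple R) :
    (\sum_(k < K) (p k)%:E * \int[nu k]_x (l1dist x (b (leaf_of T x)))%:E =
     \sum_(L < nleaves T) \sum_(k < K) (p k)%:E *
       \int[nu k]_(x in [set x | leaf_of T x = L]) (l1dist x (b L))%:E)%E.
  rewrite exchange_big /=; apply: eq_bigr => k _.
  rewrite (integral_split_leaves (nu k) T (fun L x => l1dist x (b L))).
  - rewrite ge0_sume_distrr// => L _; apply: integral_ge0 => x _.
    by rewrite lee_fin l1dist_ge0.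
  - by move=> L; exact: measurable_l1dist.
  - by move=> L x; exact: l1dist_ge0.
rewrite split_c.
under [leRHS]eq_bigr do under eq_integral do rewrite repE.
rewrite (split_c (fun L => mu (g L))).
by apply: lee_sum => L _; exact: med.
Qed.

(** Triangle inequality through [mu k]. The weights are kept in the first term, which is the
    denominator of the price, and replaced by their upper bound [a] in the displacement term. *)
Lemma representatives_le {R : realType} {d K : nat}
  (nu : 'I_K -> probability (d.-tuple R) R) (p : 'I_K -> R)
  (mu : 'I_K -> d.-tuple R) (A : {set 'I_K}) (T : dtree R d)
  (rep : d.-tuple R -> 'I_K) (a : R) :
  separates mu A T rep -> (forall k, 0 <= p k) -> (forall k, p k <= a) ->
  (\sum_(k < K) (p k)%:E * \int[nu k]_x (l1dist x (mu (rep x)))%:E <=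
   mix_expect nu p mu (fun x m => l1dist x m) +
   a%:E * \sum_(k < K) \int[nu k]_x (l1dist (mu k) (mu (rep x)))%:E)%E.
Proof.
move=> sep p0 pa.
have m0 k : (0 <= \int[nu k]_x (l1dist (mu k) (mu (rep x)))%:E)%E.
  by apply: integral_ge0 => x _; rewrite lee_fin l1dist_ge0.
have n0 k : (0 <= \int[nu k]_x (l1dist x (mu k))%:E)%E.
  by apply: integral_ge0 => x _; rewrite lee_fin l1dist_ge0.
rewrite ge0_sume_distrr// /mix_expect -big_split /=; apply: lee_sum => k _.
apply: (@le_trans _ _ ((p k)%:E * (\int[nu k]_x (l1dist x (mu k))%:E +
   \int[nu k]_x (l1dist (mu k) (mu (rep x)))%:E))%E).
  apply: lee_wpmul2l; first by rewrite lee_fin.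
  have md1 : measurable_fun setT (fun x => (l1dist x (mu k))%:E).
    by apply/measurable_EFinP; exact: measurable_l1dist.
  have md2 : measurable_fun setT (fun x => (l1dist (mu k) (mu (rep x)))%:E).
    apply/measurable_EFinP.
    exact: (sep_measurable sep (fun l => l1dist (mu k) (mu l))).
  rewrite -ge0_integralD//; last 2 first.
  - by move=> x _; rewrite lee_fin l1dist_ge0.
  - by move=> x _; rewrite lee_fin l1dist_ge0.
  apply: ge0_le_integral => //.
  - by move=> x _; rewrite lee_fin l1dist_ge0.
  - apply/measurable_EFinP; apply: measurable_sum => j.
    apply: measurableT_comp => //; apply: measurable_funB.
      exact: measurable_coord.
    exact: (sep_measurable sep (fun l => tnth (mu l) j)).
  - exact: emeasurable_funD.
  - by move=> x _; rewrite -EFinD lee_fin l1dist_triangle.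
rewrite ge0_muleDr//; apply: leeD => //.
by apply: lee_wpmul2r => //; rewrite lee_fin.
Qed.

(** * Moments of the mixture and separation of the means *)

Lemma mix_abs_dev_fin {R : realType} {d K : nat}
  (nu : 'I_K -> probability (d.-tuple R) R) (p : 'I_K -> R)
  (mu : 'I_K -> d.-tuple R) (i : 'I_d) :
  (forall k, has_mean (nu k) (mu k)) -> mix_abs_dev nu p mu i \is a fin_num.
Proof.
move=> mean; apply/sum_fin_numP => k _ _; apply: fin_numM => //.
have [int_i _] := mean k i.
have int_dev : (nu k).-integrable setT
    (fun x => (tnth x i)%:E - (tnth (mu k) i)%:E)%E.
  by apply: integrableB => //; exact: finite_measure_integrable_cst.
by have := integrable_fin_num measurableT (integrable_abse int_dev).
Qed.

Lemma mix_l1_sum {R : realType} {d K : nat}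
  (nu : 'I_K -> probability (d.-tuple R) R) (p : 'I_K -> R)
  (mu : 'I_K -> d.-tuple R) :
  mix_expect nu p mu (fun x m => l1dist x m) =
  (\sum_(i < d) mix_abs_dev nu p mu i)%E.
Proof.
rewrite /mix_abs_dev /mix_expect exchange_big /=; apply: eq_bigr => k _.
rewrite -ge0_sume_distrr; last by move=> i _; exact: integral_ge0.
congr (_ * _)%E; rewrite -ge0_integral_sum//.
- by apply: eq_integral => x _; rewrite sumEFin.
- move=> i; apply/measurable_EFinP; apply: measurableT_comp => //.
  by apply: measurable_funB => //; exact: measurable_coord.
Qed.

(** All components share the variance in coordinate [i], so averaging with weights of sum 1 does not
    change it. The hypothesis on [beta] thereby becomes a bound on [sigma i]. *)
Lemma mix_sq_devE {R : realType} {d K : nat}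
  (nu : 'I_K -> probability (d.-tuple R) R) (p : 'I_K -> R)
  (mu : 'I_K -> d.-tuple R) (sigma : 'I_d -> R) (i : 'I_d) :
  (forall k j, coord_variance (nu k) (mu k) j (sigma j ^+ 2)) ->
  \sum_(k < K) p k = 1 -> mix_sq_dev nu p mu i = (sigma i ^+ 2)%:E.
Proof.
move=> var psum; rewrite /mix_sq_dev /mix_expect.
under eq_bigr => k _.
  under eq_integral do rewrite real_normK ?num_real//.
  rewrite (var k i) -EFinM; over.
by rewrite sumEFin -mulr_suml psum mul1r.
Qed.

Lemma ENR_ge0 {R : realType} {d K : nat} (mu : 'I_K -> d.-tuple R)
  (sigma : 'I_d -> R) : (0 <= ENR mu sigma)%E.
Proof.
apply: le_bigmin => // k _; apply: le_bigmin => // l _.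
by rewrite lee_fin bigmax_ge_id.
Qed.

Lemma ENR_le {R : realType} {d K : nat} (mu : 'I_K -> d.-tuple R)
  (sigma : 'I_d -> R) (k l : 'I_K) : k != l ->
  (ENR mu sigma <= (\big[Num.max/0]_(j < d)
    (`|tnth (mu k) j - tnth (mu l) j| ^+ 2 / sigma j ^+ 2))%:E)%E.
Proof.
move=> kl; rewrite /ENR.
apply: (le_trans (bigmin_le _ k _)).
by apply: bigmin_le_cond; rewrite eq_sym.
Qed.

Lemma ENR_separation {R : realType} {d K : nat} (mu : 'I_K -> d.-tuple R)
  (sigma : 'I_d -> R) (r : R) (k l : 'I_K) :
  (forall j, 0 < sigma j) -> 0 < r -> ENR mu sigma = r%:E -> k != l ->
  exists j, Num.sqrt r * sigma j <= `|tnth (mu k) j - tnth (mu l) j|.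
Proof.
move=> sig0 r0 qr kl; have := ENR_le mu sigma _ _ kl.
(* A maximum at least [r] is attained at some [j] or is the default 0, and [r > 0] excludes the
   latter. *)
rewrite qr lee_fin => /bigmax_geP[|[j _ h]]; first by rewrite leNgt r0.
exists j; rewrite -ler_sqr ?nnegrE ?mulr_ge0 ?sqrtr_ge0 ?(ltW (sig0 j))//.
by rewrite exprMn sqr_sqrtr ?(ltW r0)// -ler_pdivlMr ?exprn_gt0.
Qed.

Lemma separates_valid {R : realType} {d K : nat} (mu : 'I_K -> d.-tuple R)
  (T : dtree R d) (rep : d.-tuple R -> 'I_K) :
  separates mu [set: 'I_K]%SET T rep -> valid_tree mu T.
Proof.
move=> sep; split; first by rewrite (sep_nleaves sep) cardsT card_ord.
move=> L LT; have [k kT kL] := sep_surj sep L LT.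
exists k; split=> // l lL; apply: (sep_inj sep); rewrite ?inE//.
by rewrite /= kL lL.
Qed.

(** * Bounding the price *)

(** The separation is stated with a free [rho0] instead of the square root of [ENR mu sigma], so
    that an infinite ratio is covered as well. *)
Lemma exists_tree_price_le {R : realType} {d K : nat}
  (nu : 'I_K -> probability (d.-tuple R) R) (p : 'I_K -> R)
  (mu : 'I_K -> d.-tuple R) (sigma : 'I_d -> R) (alpha beta rho0 : R) :
  (forall k, has_mean (nu k) (mu k)) ->
  (forall k, symmetric_about (nu k) (mu k)) ->
  (forall j, 0 < sigma j) ->
  (forall k j, coord_variance (nu k) (mu k) j (sigma j ^+ 2)) ->
  (forall k, 0 <= p k) -> \sum_(k < K) p k = 1 ->
  1 <= alpha -> (forall k, p k <= alpha / K%:R) ->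
  (forall i : 'I_d, ((Num.sqrt (fine (mix_sq_dev nu p mu i)))%:E
                     <= beta%:E * mix_abs_dev nu p mu i)%E) ->
  0 < rho0 ->
  (forall k l, k != l ->
     exists j, rho0 * sigma j <= `|tnth (mu k) j - tnth (mu l) j|) ->
  exists T : dtree R d, valid_tree mu T /\
    forall c : nat -> d.-tuple R, leaf_medians nu p T c ->
      (price nu p mu T c <=
       (1 + (4 + 2 * pi ^+ 2 / 3) * alpha * beta
            * (K%:R * (K%:R - 1)) / rho0)%:E)%E.
Proof.
move=> mean sym sig0 var p0 psum alpha1 palpha hbeta rho00 far.
have K0 : (0 < K)%N.
  case: K p psum {nu mu mean sym var p0 palpha hbeta far} => // p.
  by rewrite big_ord0 => /eqP; rewrite eq_sym oner_eq0.
have KR0 : 0 < K%:R :> R by rewrite ltr0n.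
have [T [rep [sep cost]]] : exists (T : dtree R d) (rep : d.-tuple R -> 'I_K),
    separates mu [set: 'I_K]%SET T rep /\
    (\sum_(k < K) \int[nu k]_x (l1dist (mu k) (mu (rep x)))%:E <=
     (2 * pi ^+ 2 / 3 * (\sum_j sigma j) / rho0
      * (K%:R ^+ 2 * (K%:R - 1)))%:E)%E.
  have [|T [rep [sep cost]]] := exists_separating_tree nu mu sigma rho0
    [set: 'I_K]%SET sym sig0 var rho00 far; first by rewrite cardsT card_ord.
  exists T, rep; split=> //; move: cost; rewrite cardsT card_ord.
  by rewrite (eq_bigl xpredT) // => k; rewrite inE.
exists T; split; first exact: separates_valid sep.
move=> c med.
pose a i := fine (mix_abs_dev nu p mu i).
have aE i : mix_abs_dev nu p mu i = (a i)%:E by rewrite fineK// mix_abs_dev_fin.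
have a0 i : 0 <= a i.
  rewrite fine_ge0//; apply: sume_ge0 => k _; apply: mule_ge0.
    by rewrite lee_fin.
  by apply: integral_ge0 => x _; rewrite lee_fin.
have sig_le i : sigma i <= beta * a i.
  have := hbeta i; rewrite (mix_sq_devE _ _ _ _ _ var psum) aE /= lee_fin.
  by rewrite sqrtr_sqr gtr0_norm.
set E := \sum_i a i; set s := \sum_j sigma j in cost.
have EE : mix_expect nu p mu (fun x m => l1dist x m) = E%:E.
  by rewrite mix_l1_sum /E -sumEFin; apply: eq_bigr => i _; rewrite aE.
have E0 : 0 <= E by exact: sumr_ge0.
have sE : s <= beta * E by rewrite mulr_sumr; exact: ler_sum.
have alpha0 : 0 <= alpha by exact: le_trans alpha1.
(* The sign of [beta] is not given. Two distinct components force a coordinate [j] to exist, and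
   [0 < sigma j <= beta * a j] with [0 <= a j] rules out [beta < 0]; for [K = 1] the product is
   zero. *)
have betaK : 0 <= beta * (K%:R * (K%:R - 1)).
  have [K1|K2] := leqP K 1.
    have -> : K = 1%N by apply/eqP; rewrite eqn_leq K1.
    by rewrite subrr !mulr0.
  apply: mulr_ge0; last first.
    by apply: mulr_ge0; [exact: ltW|rewrite subr_ge0 -[1]/(1%:R) ler_nat].
  have [j _] : exists j, rho0 * sigma j <=
      `|tnth (mu (Ordinal K0)) j - tnth (mu (Ordinal K2)) j| by exact: far.
  rewrite leNgt; apply/negP => b0.
  have := sig_le j; rewrite leNgt => /negP; apply.
  by apply: le_lt_trans (sig0 j); rewrite mulr_le0_ge0// ltW.
set c0 := 2 * pi ^+ 2 / 3 : R.
have c00 : 0 <= c0.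
  by apply: divr_ge0 => //; apply: mulr_ge0 => //; exact: sqr_ge0.
have num : (\sum_(k < K) (p k)%:E *
      \int[nu k]_x (l1dist x (c (leaf_of T x)))%:E <=
    (E + alpha / K%:R * (c0 * s / rho0 * (K%:R ^+ 2 * (K%:R - 1))))%:E)%E.
  apply: le_trans (medians_le_representatives _ _ _ _ _ _ _ sep med) _.
  apply: le_trans (representatives_le nu p _ _ _ _ _ sep p0 palpha) _.
  rewrite EE EFinD; apply: leeD => //; rewrite [leRHS]EFinM.
  apply: lee_wpmul2l => //.
  by rewrite lee_fin divr_ge0// ltW.
rewrite /price EE /=.
have Ei : 0 <= E^-1 by rewrite invr_ge0.
apply: (le_trans (lee_wpmul2r _ num)); first by rewrite lee_fin.
rewrite -EFinM lee_fin.
have rest : 0 <= (4 + c0) * alpha * beta * (K%:R * (K%:R - 1)) / rho0.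
  apply: divr_ge0; last exact: ltW.
  rewrite -mulrA; apply: mulr_ge0 => //.
  by apply: mulr_ge0 => //; apply: addr_ge0.
(* If [E = 0], as when [d = 0], the inverse is 0 by convention and the left-hand side vanishes. *)
move: E0; rewrite le_eqVlt => /orP[/eqP <-|E0].
  by rewrite invr0 mulr0 addr_ge0.
rewrite mulrDl divff ?gt_eqF// lerD2l.
(* The weight bound [alpha / K] cancels one factor [K] of [K^2 (K - 1)], and [s / E <= beta]. *)
apply: (@le_trans _ _ (c0 * alpha * (beta * (K%:R * (K%:R - 1))) / rho0)).
  have -> : alpha / K%:R * (c0 * s / rho0 * (K%:R ^+ 2 * (K%:R - 1))) / E =
     (c0 * alpha * (K%:R * (K%:R - 1)) / rho0) * (s / E).
    move: c0 c00 {rest num} => c0 c00.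
    by field; rewrite !gt_eqF.
  have -> : c0 * alpha * (beta * (K%:R * (K%:R - 1))) / rho0 =
     (c0 * alpha * (K%:R * (K%:R - 1)) / rho0) * beta.
    move: c0 c00 {rest num} => c0 c00.
    by field; rewrite !gt_eqF.
  apply: ler_wpM2l; last by rewrite ler_pdivrMr.
  apply: divr_ge0; last exact: ltW.
  apply: mulr_ge0; first exact: mulr_ge0.
  by apply: mulr_ge0; [exact: ltW|rewrite subr_ge0 -[1]/(1%:R) ler_nat].
apply: ler_wpM2r; first by rewrite invr_ge0 ltW.
rewrite -[leRHS]mulrA; apply: ler_wpM2r => //.
by apply: ler_wpM2r => //; rewrite lerDr.
Qed.

Theorem theorem3 (R : realType) (d K : nat)
  (nu : 'I_K -> probability (d.-tuple R) R) (p : 'I_K -> R)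
  (mu : 'I_K -> d.-tuple R) (sigma : 'I_d -> R) (alpha beta : R) :
  (forall k, discrete_distr (nu k) \/ abs_continuous (nu k)) ->
  (forall k, has_mean (nu k) (mu k)) ->
  (forall k, symmetric_about (nu k) (mu k)) ->
  (forall j, 0 < sigma j) ->
  (forall k j, coord_variance (nu k) (mu k) j (sigma j ^+ 2)) ->
  (forall k, 0 <= p k) -> \sum_(k < K) p k = 1 ->
  1 <= alpha -> (forall k, p k <= alpha / K%:R) ->
  (forall i : 'I_d, ((Num.sqrt (fine (mix_sq_dev nu p mu i)))%:E
                     <= beta%:E * mix_abs_dev nu p mu i)%E) ->
  ENR mu sigma != 0%E ->
  exists T : dtree R d, valid_tree mu T /\
    forall c : nat -> d.-tuple R, leaf_medians nu p T c ->
      (price nu p mu T c <=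
       price_bound ((4 + 2 * pi ^+ 2 / 3) * alpha * beta
                    * (K%:R * (K%:R - 1))) (ENR mu sigma))%E.
Proof.
move=> _ mean sym sig0 var p0 psum alpha1 palpha hbeta.
have := ENR_ge0 mu sigma; case qE: (ENR mu sigma) => [r| |]//.
- rewrite lee_fin => r0 rn0; have {}r0 : 0 < r by rewrite lt_neqAle eq_sym rn0.
  rewrite /price_bound gt_eqF//.
  apply: exists_tree_price_le => //; first by rewrite sqrtr_gt0.
  by move=> k l; exact: ENR_separation.
- move=> _ _.
  (* Two distinct components would bound the ratio by a finite maximum. With at most one component
     the separation condition is vacuous, so any positive [rho0] works and 1 is taken. *)
  have K_le1 : forall k l : 'I_K, k = l.
    move=> k l; apply/eqP/negP => /negP kl.
    by have := ENR_le mu sigma _ _ kl; rewrite qE leye_eq.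
  have K1 : K%:R * (K%:R - 1) = 0 :> R.
    case: K K_le1 {nu p mu mean sym var p0 psum palpha hbeta qE} => [|[|K]] h.
    + by rewrite mul0r.
    + by rewrite subrr mulr0.
    + by have := h ord0 ord_max.
  have [|T [vT bT]] := exists_tree_price_le nu p mu sigma alpha beta 1
    mean sym sig0 var p0 psum alpha1 palpha hbeta ltr01.
    by move=> k l; rewrite (K_le1 k l) eqxx.
  exists T; split=> // c /bT; rewrite K1 mulr0 mul0r addr0.
  exact.
Qed.
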